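(* Consider the interference-limited, heavily loaded dedicated network with $p_{t_i}=p_{t_i}^*=1$ and $p_{f_i}=p_{f_i}^*=\min\{1,\tilde b_i/\theta\}$ for all $i=1,\dots,M$, and let $$d_{\mathrm{rate}}^{(O)}=\sum_{j=1}^M\lambda_{D_j}R_{Dl_j}^{(O)}+\lambda_UR_{Cl}^{(O)}$$ be the rate density built from the rate lower bounds $$R_{Dl_j}^{(O)}=\sup_\beta\ \min\{p_{f_j}^*\theta B,\,b_{D_j}\}\log_2(1+\beta)\,\mathbb{P}_D^{(O)}(\beta),\qquad R_{Cl}^{(O)}=\sup_\beta\ b_C\,p_a^{(O)}\log_2(1+\beta)\,\mathbb{P}_C^{(O)}(\beta),$$ regarded as a function of the resource partition $\theta\in[0,1]$. Let $\beta_D$ and $\beta_C$ be the values of $\beta$ attaining the suprema in the D2D and cellular lower bounds, respectively. Then the optimal $\theta$ to maximize $d_{\mathrm{rate}}^{(O)}$ belongs to the set $$\mathcal{O}=\left\{\left[\tilde b_i'\right]_{\tilde b_i}^{\min\{1,\tilde b_{i+1}\}}:\ i=0,\dots,L\right\},$$ where $[x]_a^b=\min\{\max\{x,a\},b\}$ and $$\tilde b_i'=\begin{cases}1,&\text{if }E_i\ge DF_i,\\[2pt]\sqrt{\dfrac{C_i(A_iF_i-E_iC_i)}{F_i^2(DF_i-E_i)}}-\dfrac{C_i}{F_i},&\text{otherwise.}\end{cases}$$ In other words, $\theta^*=\arg\max_{\theta\in\mathcal{O}}d_{\mathrm{rate}}^{(O)}$.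
   Context: In the dedicated network a fraction $\theta$ of the $B$ subbands is allocated to D2D and $(1-\theta)B$ to the cellular network. There are $M$ types of potential D2D links with densities $\lambda_{D_i}$ and demands of $b_{D_i}$ subbands; cellular users have density $\lambda_U$ and demand $b_C$ subbands each; $\lambda_B$ is the base station density; $\delta$ is the parameter of the Rayleigh distributed distance between a D2D transmitter and its receiver; $\alpha$ is the path loss exponent; $p_{t_i},p_{f_i}$ are the time hopping probability (probability of operating in D2D mode) and frequency hopping probability of type-$i$ links. Interference-limited means noise power $\sigma^2\to0$, in which case the SINR distributions of D2D links and cellular users are $$\mathbb{P}_D^{(O)}(\beta)=\frac{1}{1+2\delta^2\frac{2\pi^2/\alpha}{\sin(2\pi/\alpha)}\beta^{2/\alpha}\sum_{i=1}^M p_{t_i}p_{f_i}\lambda_{D_i}},\qquad \mathbb{P}_C^{(O)}(\beta)=\frac{1}{2H_1(\beta,\alpha)+1},\qquad H_1(\beta,\alpha)=\int_1^\infty\frac{x}{1+\beta^{-1}x^\alpha}dx.$$ Heavily loaded means $7(1-\theta)B\lambda_B<9b_C\lambda_U$, so that base stations transmit on all their resource blocks (already used in $\mathbb{P}_C^{(O)}$ above) and, with all $p_{t_i}=1$, the admission probability of cellular users is $p_a^{(O)}=\frac{7(1-\theta)B\lambda_B}{9b_C\lambda_U}$. Set $\tilde b_0=0$ and $\tilde b_i=b_{D_i}/B$ for $i=1,\dots,M$, with types ordered so that the sequence $\tilde b_0,\tilde b_1,\dots,\tilde b_M$ is in ascending order. $\tilde b_L$ is the largest $\tilde b_i$ that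 is smaller than 1, and $\min\{1,\tilde b_{M+1}\}$ is read as $1$. For $i=0,\dots,L$ let $\mathcal{S}_i=\{0,\dots,i\}$ and $\mathcal{G}_i=\{i+1,\dots,M\}$ (the index $0$ contributes $0$ to every sum below), and $$A_i=B\log_2(\beta_D+1)\sum_{j\in\mathcal{S}_i}\lambda_{D_j}\tilde b_j,\qquad C_i=2\delta^2\frac{2\pi^2/\alpha}{\sin(2\pi/\alpha)}\beta_D^{2/\alpha}\sum_{j\in\mathcal{S}_i}\lambda_{D_j}\tilde b_j,$$ $$D=\frac{7B\lambda_B}{9}\,\frac{\log_2(\beta_C+1)}{2H_1(\beta_C,\alpha)+1},\qquad E_i=B\log_2(\beta_D+1)\sum_{j\in\mathcal{G}_i}\lambda_{D_j},\qquad F_i=2\delta^2\frac{2\pi^2/\alpha}{\sin(2\pi/\alpha)}\beta_D^{2/\alpha}\sum_{j\in\mathcal{G}_i}\lambda_{D_j}+1.$$ *)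

(* Defs.v *)
From HB Require Import structures.
From mathcomp Require Import all_boot all_order all_algebra.
From mathcomp Require Import all_classical all_reals all_analysis.

Set Implicit Arguments.
Unset Strict Implicit.
Unset Printing Implicit Defensive.

Import Order.TTheory GRing.Theory Num.Theory.
Import numFieldNormedType.Exports.

Local Open Scope classical_set_scope.
Local Open Scope ring_scope.

(* The D2D types are numbered 1, ..., M: lambdaD and bD are only ever read at
   indices in that range. *)
Record network (R : realType) := Network {
  M : nat;                (* number of D2D types *)
  B : R;                  (* number of subbands *)
  lambdaD : nat -> R;     (* D2D link densities *)
  bD : nat -> R;          (* D2D demands, in subbands *)
  lambdaU : R;            (* cellular user density *)
  bC : R;                 (* cellular demand, in subbands *)
  lambdaB : R;            (* base station density *)
  delta : R;              (* Rayleigh parameter of the D2D link distance *)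
  alpha : R               (* path loss exponent *)
}.

Section Dedicated.
Context {R : realType}.
Implicit Types (N : network R) (theta beta betaD betaC x : R) (i j : nat).

Definition argmax (f : R -> R) (A : set R) : set R :=
  [set x | A x /\ forall y, A y -> f y <= f x].

Definition log2 x : R := ln x / ln 2.

Definition bt N i : R := if i is 0 then 0 else bD N i / B N.

Definition interf N : R :=
  2 * delta N ^+ 2 * ((2 * pi ^+ 2 / alpha N) / sin (2 * pi / alpha N)).

Definition PD N (pt pf : nat -> R) beta : R :=
  1 / (1 + interf N * beta `^ (2 / alpha N)
           * \sum_(1 <= i < (M N).+1) pt i * pf i * lambdaD N i).

Definition H1 beta a : R :=
  (\int[lebesgue_measure]_(x in `[1%R, +oo[) (x / (1 + beta^-1 * x `^ a)))%R.

Definition PC N beta : R := 1 / (2 * H1 beta (alpha N) + 1).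

Definition heavily_loaded N theta : Prop :=
  7 * (1 - theta) * B N * lambdaB N < 9 * bC N * lambdaU N.

(* The admission probability under heavy load, for p_t = 1. *)
Definition pa N theta : R :=
  (7 * (1 - theta) * B N * lambdaB N) / (9 * bC N * lambdaU N).

Definition pt_opt : nat -> R := fun=> 1.

(* min {1, bt i / theta}, with bt i / 0 read as +oo since bt i > 0. *)
Definition pf_opt N theta i : R :=
  if theta == 0 then 1 else Num.min 1 (bt N i / theta).

Definition RD_at N theta j beta : R :=
  Num.min (pf_opt N theta j * theta * B N) (bD N j)
  * log2 (1 + beta) * PD N pt_opt (pf_opt N theta) beta.

Definition RC_at N theta beta : R :=
  bC N * pa N theta * log2 (1 + beta) * PC N beta.

(* SINR thresholds range over the positive reals. *)
Definition thresholds : set R := [set beta | 0 < beta].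

Definition RD N theta j : R := sup [set RD_at N theta j beta | beta in thresholds].

Definition RC N theta : R := sup [set RC_at N theta beta | beta in thresholds].

Definition rate_density N theta : R :=
  \sum_(1 <= j < (M N).+1) lambdaD N j * RD N theta j + lambdaU N * RC N theta.

Definition coeff_A N betaD i : R :=
  B N * log2 (betaD + 1) * \sum_(1 <= j < i.+1) lambdaD N j * bt N j.

Definition coeff_C N betaD i : R :=
  interf N * betaD `^ (2 / alpha N)
  * \sum_(1 <= j < i.+1) lambdaD N j * bt N j.

Definition coeff_D N betaC : R :=
  7 * B N * lambdaB N / 9 * (log2 (betaC + 1) / (2 * H1 betaC (alpha N) + 1)).

Definition coeff_E N betaD i : R :=
  B N * log2 (betaD + 1) * \sum_(i.+1 <= j < (M N).+1) lambdaD N j.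

Definition coeff_F N betaD i : R :=
  interf N * betaD `^ (2 / alpha N)
  * (\sum_(i.+1 <= j < (M N).+1) lambdaD N j) + 1.

Definition bt' N betaD betaC i : R :=
  let A := coeff_A N betaD i in let C := coeff_C N betaD i in
  let D := coeff_D N betaC in
  let E := coeff_E N betaD i in let F := coeff_F N betaD i in
  if D * F <= E then 1
  else Num.sqrt (C * (A * F - E * C) / (F ^+ 2 * (D * F - E))) - C / F.

Definition clamp (a b x : R) : R := Num.min (Num.max x a) b.

(* The largest index with bt i < 1 (bt is nondecreasing, and bt 0 = 0). *)
Definition L N : nat := \max_(i < (M N).+1 | bt N i < 1) i.

(* min {1, bt i.+1}, read as 1 when i = M. *)
Definition right_end N i : R :=
  if (i < M N)%N then Num.min 1 (bt N i.+1) else 1.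

(* PD depends on theta through pf_opt, and so does the beta attaining the D2D
   suprema; betaD and betaC are meant to be the values attaining the suprema at
   an optimal theta. *)
Definition candidates N betaD betaC : set R :=
  [set clamp (bt N i) (right_end N i) (bt' N betaD betaC i)
     | i in [set i : nat | (i <= L N)%N]].

End Dedicated.

(* Main.v *)
(* For 0 < theta all D2D types see the same interference, so that the D2D part
   of the rate density is the supremum over beta of
     B log2(1 + beta) s / (1 + kappa(beta) s / theta),
   with s = sum_j lambda_j min(theta, bt_j) and kappa(beta) = K beta^(2/alpha),
   while the cellular part is a constant multiple of 1 - theta.  As theta grows,
   s increases and s / theta decreases; this makes the rate density Lipschitz,
   hence a maximizer exists.  Freezing beta at the values attaining the suprema
   at an optimal theta gives a minorant of the rate density that touches it at
   that theta.  On [bt_i, bt_(i+1)] the minorant is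
     theta (A + E theta) / (C + F theta) + (1 - theta) D,
   whose maximizer on that interval is the clamped stationary point; it is
   unique unless i = 0 and E = D F, where the minorant is constant. *)

Require Import Defs.
From HB Require Import structures.
From mathcomp Require Import all_boot all_order all_algebra.
From mathcomp Require Import all_classical all_reals all_analysis.
From mathcomp Require Import measurable_realfun ring lra.
Set Implicit Arguments.
Unset Strict Implicit.
Import Order.TTheory GRing.Theory Num.Theory.
Import numFieldNormedType.Exports.
Local Open Scope classical_set_scope.
Local Open Scope ring_scope.

(** * Suprema, clamping, and the maximum of the linear-fractional minorant on an interval *)

Lemma sup_imageZ (R : realType) (T : Type) (c : R) (g : T -> R) (S : set T) :
  0 <= c -> S !=set0 -> has_ubound [set g x | x in S] ->
  sup [set c * g x | x in S] = c * sup [set g x | x in S].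
Proof.
move=> c0 [s Ss] bg; apply/eqP; rewrite eq_le; apply/andP; split.
  apply: ge_sup; first by exists (c * g s), s.
  by move=> _ [x Sx <-]; rewrite ler_wpM2l//; apply: ub_le_sup => //; exists x.
have [->|cn0] := eqVneq c 0.
  rewrite mul0r; apply: ub_le_sup; last by exists s => //; rewrite mul0r.
  by exists 0 => _ [x _ <-]; rewrite mul0r.
have cp : 0 < c by rewrite lt_def cn0.
rewrite mulrC -ler_pdivlMr//; apply: ge_sup; first by exists (g s), s.
move=> _ [x Sx <-]; rewrite ler_pdivlMr// mulrC; apply: ub_le_sup; last by exists x.
have [M' ubM] := bg; exists (c * M') => _ [y Sy <-].
by rewrite ler_wpM2l//; apply: ubM; exists y.
Qed.

Lemma sup_argmax (R : realType) (f : R -> R) (A : set R) (x : R) :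
  argmax f A x -> sup [set f y | y in A] = f x.
Proof.
move=> [Ax fx]; apply/eqP; rewrite eq_le; apply/andP; split.
  by apply: ge_sup => [|_ [y Ay <-]]; [exists (f x), x|exact: fx].
by apply: ub_le_sup; [exists (f x) => _ [y Ay <-]; exact: fx|exists x].
Qed.

Lemma clamp_bounds (R : realType) (a b x : R) : a <= b -> a <= clamp a b x <= b.
Proof. by move=> ab; rewrite /clamp le_min le_max lexx orbT ab ge_min lexx orbT. Qed.

(** A value below some [t <= b] is not cut off by [b], so it is the maximum of [x] and [a]. With
    [clamp_lt], this locates the unclamped peak relative to the clamped one and a competing
    point. *)
Lemma clamp_gt (R : realType) (a b x t : R) : t <= b -> clamp a b x < t -> x <= clamp a b x.
Proof.
move=> tb; rewrite /clamp gt_min => /orP[|]; last by move=> /lt_le_trans/(_ tb); rewrite ltxx.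
by move=> mt; rewrite (min_idPl _) ?le_max ?lexx//; exact: le_trans (ltW mt) tb.
Qed.

Lemma clamp_lt (R : realType) (a b x t : R) : a <= t -> t < clamp a b x -> clamp a b x <= x.
Proof.
move=> at_; rewrite /clamp lt_min lt_max => /andP[/orP[tx _|ta]]; last by rewrite ltNge at_ in ta.
by rewrite ge_min (max_idPl _) ?lexx//; exact: le_trans at_ (ltW tx).
Qed.

(* The D2D and cellular rates of the i-th interval at fixed thresholds, with the
   coefficients A_i, C_i, D, E_i, F_i; at C = theta = 0 division by zero gives
   the right value D. *)
Definition lfrac (R : realType) (A C D E F t : R) : R :=
  t * (A + E * t) / (C + F * t) + (1 - t) * D.

(** Stands in for the derivative: the sign of an increment is read off by comparing [C (A F - E C)]
    with [D F - E] times the product of the two denominators. *)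
Lemma lfracB (R : realType) (A C D E F s t : R) :
  F != 0 -> C + F * s != 0 -> C + F * t != 0 ->
  lfrac A C D E F t - lfrac A C D E F s =
  (t - s) / (F * (C + F * s) * (C + F * t))
    * (C * (A * F - E * C) - (D * F - E) * ((C + F * s) * (C + F * t))).
Proof. by move=> F0 s0 t0; rewrite /lfrac; field; rewrite F0 s0 t0. Qed.

(** The formula of [bt'] with free coefficients. In the second branch it is the root of
    [(D F - E) (C + F t)^2 = C (A F - E C)] with [C + F t >= 0]. *)
Definition lfrac_peak (R : realType) (A C D E F : R) : R :=
  if D * F <= E then 1
  else Num.sqrt (C * (A * F - E * C) / (F ^+ 2 * (D * F - E))) - C / F.

(** If [t] differed from the clamped peak [c], then [c] would lie strictly between [t] and the peak
    or at the peak, and [lfracB] would make the value at [c] strictly larger. *)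
Lemma lfrac_argmax (R : realType) (A C D E F a b t : R) :
  0 < F -> 0 < C -> 0 < A * F - E * C -> 0 <= a -> a <= b -> b <= 1 ->
  argmax (lfrac A C D E F) `[a, b] t ->
  t = clamp a b (lfrac_peak A C D E F).
Proof.
move=> F0 C0 P0 a0 ab b1 [/=]; rewrite in_itv/= => /andP[at_ tb] tmax.
set c := clamp _ _ _.
have /andP[ac cb] : a <= c <= b by exact: clamp_bounds.
have CP : 0 < C * (A * F - E * C) by exact: mulr_gt0.
have u0 x : a <= x -> 0 < C + F * x.
  by move=> ax; rewrite ltr_wpDr// mulr_ge0 ?(ltW F0)// (le_trans a0).
have := tmax c; rewrite /= in_itv/= ac cb => /(_ isT).
have diff := @lfracB _ A C D E F c t (lt0r_neq0 F0) (lt0r_neq0 (u0 _ ac)) (lt0r_neq0 (u0 _ at_)).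
have Fuv : 0 < F * (C + F * c) * (C + F * t) by rewrite !mulr_gt0// u0.
rewrite -subr_ge0 diff mulrAC pmulr_lge0 ?invr_gt0//.
have uv0 : 0 < (C + F * c) * (C + F * t) by rewrite mulr_gt0// u0.
(* With [y = C + F * peak], the last factor of [lfracB] becomes [(D F - E) (y^2 - u v)], where [u]
   and [v] are the denominators at [c] and [t]. *)
have peakE : D * F <= E \/ E < D * F /\
    (C + F * lfrac_peak A C D E F) ^+ 2 * (D * F - E) = C * (A * F - E * C) /\
    0 <= C + F * lfrac_peak A C D E F.
  have [|lt] := leP (D * F) E; [by left|right; split => //].
  have q0 : 0 < D * F - E by rewrite subr_gt0.
  rewrite /lfrac_peak leNgt lt/=; set r := Num.sqrt _.
  have -> : C + F * (r - C / F) = F * r by field; rewrite lt0r_neq0.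
  rewrite exprMn sqr_sqrtr; last by rewrite divr_ge0// ?mulr_ge0 ?sqr_ge0// ltW.
  split; last by rewrite mulr_ge0 ?sqrtr_ge0// ltW.
  by field; rewrite !lt0r_neq0.
have [ct|tc|//] := ltgtP c t.
- have xc : lfrac_peak A C D E F <= c by apply: (@clamp_gt _ a b _ t).
  rewrite pmulr_rge0 ?subr_gt0//.
  case: peakE => [DFE|[DFE [y2 y0]]].
    by move: xc; rewrite /lfrac_peak DFE => /le_lt_trans/(_ ct); lra.
  (* Maximality of [t] forces [y^2 >= u v], while [0 <= y <= u < v] and [0 < u] give [y^2 < u v].
     The case [t < c] is the mirror image. *)
  rewrite -y2 mulrC -mulrBr pmulr_rge0 ?subr_gt0// subr_ge0 => H; exfalso.
  have : C + F * lfrac_peak A C D E F <= C + F * c by rewrite lerD2l ler_pM2l.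
  have : C + F * c < C + F * t by rewrite ltrD2l ltr_pM2l.
  move: H y0 (u0 _ ac); rewrite expr2.
  by move: (C + F * c) (C + F * t) (C + _) => u v y; nra.
- have cx : c <= lfrac_peak A C D E F by apply: (@clamp_lt _ a b _ t).
  rewrite nmulr_rge0 ?subr_lt0//.
  case: peakE => [DFE|[DFE [y2 y0]]].
    by move=> H; exfalso; nra.
  rewrite -y2 mulrC -mulrBr pmulr_rle0 ?subr_gt0// subr_le0 => H; exfalso.
  have : C + F * c <= C + F * lfrac_peak A C D E F by rewrite lerD2l ler_pM2l.
  have : C + F * t < C + F * c by rewrite ltrD2l ltr_pM2l.
  move: H y0 (u0 _ at_); rewrite expr2.
  by move: (C + F * c) (C + F * t) (C + _) => u v y; nra.
Qed.

(** * Growth of the logarithm against powers, and integrability of powers *)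

(** [g ln (1 + b)] is the logarithm of [(1 + b)^g], hence at most [(1 + b)^g <= (2 max(1, b))^g <= 2
    (1 + b^g)]. This is what makes both suprema over thresholds finite. *)
Lemma ln1D_le_powR (R : realType) (g b : R) : 0 < g -> g <= 1 -> 0 <= b ->
  ln (1 + b) <= 2 / g * (1 + b `^ g).
Proof.
move=> g0 g1 b0.
have p0 : 0 < (1 + b) `^ g by rewrite powR_gt0//; lra.
have : g * ln (1 + b) <= (1 + b) `^ g by rewrite -ln_powR ltW// ln_sublinear.
have bg := powR_ge0 b g.
have : (1 + b) `^ g <= 2 * (1 + b `^ g).
  have m0 : 0 <= Num.max 1 b by rewrite le_max ler01.
  apply: (@le_trans _ _ ((2 * Num.max 1 b) `^ g)).
    apply: ge0_ler_powR; rewrite ?nnegrE; [lra|lra|lra|].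
    have : 1 <= Num.max 1 b by rewrite le_max lexx.
    have : b <= Num.max 1 b by rewrite le_max lexx orbT.
    lra.
  rewrite powRM//; apply: ler_pM; rewrite ?powR_ge0//.
    by apply: ler1_powR => //; lra.
  by case: (leP 1 b); rewrite ?powR1; lra.
move=> H1 H2; rewrite mulrAC ler_pdivlMr// mulrC; lra.
Qed.

Lemma cvgy_powRN (R : realType) (p : R) : 0 < p -> x `^ (- p) @[x --> +oo] --> (0 : R).
Proof.
move=> p0; apply/cvgrPdist_lt => e e0; near=> x.
have x0 : 0 < x by near: x; exact: nbhs_pinfty_gt.
have ep : 0 < e^-1 `^ p^-1 by rewrite powR_gt0// invr_gt0.
rewrite sub0r normrN ger0_norm ?powR_ge0// powRN -[ltRHS]invrK.
rewrite ltf_pV2 ?posrE ?invr_gt0 ?powR_gt0//.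
have -> : e^-1 = (e^-1 `^ p^-1) `^ p.
  by rewrite -powRrM mulVf ?lt0r_neq0// powRr1// invr_ge0 ltW.
have ep0 := ltW ep; have x0' := ltW x0.
apply: (gt0_ltr_powR p0) => //.
Unshelve. all: end_near.
Qed.

(** The antiderivative [- x^(1 - p) / (p - 1)] tends to 0 at infinity. *)
Lemma integral_powR_lty (R : realType) (p : R) : 1 < p ->
  (\int[lebesgue_measure]_(x in `[1%R, +oo[) (x `^ (- p))%:E < +oo)%E.
Proof.
move=> p1; have q0 : 0 < p - 1 by rewrite subr_gt0.
have dF (x : R) : 1 < x ->
    is_derive x 1 (fun x : R => - (p - 1)^-1 * x `^ (- (p - 1))) (x `^ (- p)).
  move=> x1; have x0 : 0 < x by exact: lt_trans x1.
  have := is_deriveZ (- (p - 1)^-1) (is_derive1_powR (- (p - 1)) x0).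
  rewrite -opprD subrK /GRing.scale/= mulrA mulrNN mulVf ?gt_eqF// mul1r.
  exact.
have cP (r x : R) : 0 < x -> {for x, continuous (@powR R ^~ r)}.
  move=> x0; apply: differentiable_continuous; apply/derivable1_diffP.
  by have [] := is_derive1_powR r x0.
rewrite (@ge0_continuous_FTC2y _ _
  (fun x => - (p - 1)^-1 * x `^ (- (p - 1))) 1 0) ?ltry//.
- by move=> x _; exact: powR_ge0.
- apply: continuous_in_subspaceT => x; rewrite inE/= in_itv/= andbT => x1.
  by apply: cP; exact: lt_le_trans x1.
- by rewrite -[X in _ --> X](mulr0 (- (p - 1)^-1)); apply: cvgMr; exact: cvgy_powRN.
- by move=> x /dF[].
- by apply: cvg_at_right_filter; apply: cvgMr; exact: cP.
- by move=> x; rewrite in_itv/= andbT => /dF[_ <-]; rewrite derive1E.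
Qed.

(** * The cellular interference integral *)

Section H1bounds.
Context {R : realType}.
Context (beta a : R) (beta0 : 0 < beta) (a2 : 2 < a).

Let a0 : 0 < a. Proof. by apply: lt_trans a2. Qed.

Let f (x : R) := x / (1 + beta^-1 * x `^ a).

Let den_gt0 (x : R) : 0 < 1 + beta^-1 * x `^ a.
Proof. by rewrite ltr_pwDl// mulr_ge0 ?powR_ge0// invr_ge0 ltW. Qed.

Let f_ge0 (x : R) : 0 <= x -> 0 <= f x.
Proof. by move=> x0; rewrite divr_ge0// ltW. Qed.

Let mf (D : set R) : measurable D -> measurable_fun D f.
Proof.
move=> mD; apply: (measurable_funS measurableT) => //.
have -> : f = fun x => x * (1 + beta^-1 * x `^ a) `^ (- 1).
  by apply/funext => x; rewrite powR_inv1// ltW.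
apply: measurable_funM => //.
apply: (measurableT_comp (measurable_powR (- 1))).
apply: measurable_funD => //; exact: measurable_funM.
Qed.

(** Dropping the 1 in the denominator bounds the integrand by [beta x^(1 - a)], integrable because
    [a > 2]. Finiteness lets inequalities between extended integrals pass to the real number
    [H1]. *)
Lemma H1_integral_fin_num :
  (\int[lebesgue_measure]_(x in `[1%R, +oo[) (f x)%:E)%E \is a fin_num.
Proof.
have f0 x : `[1, +oo[%classic x -> (0 <= (f x)%:E)%E.
  by rewrite /= in_itv/= andbT lee_fin => x1; apply: f_ge0; exact: le_trans x1.
rewrite ge0_fin_numE; last exact: integral_ge0.
apply: (@le_lt_trans _ _ (\int[lebesgue_measure]_(x in `[1%R, +oo[)
    (beta%:E * (x `^ (- (a - 1)))%:E))%E).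
  apply: ge0_le_integral => //.
  - by apply/measurable_EFinP; exact: mf.
  - apply/measurable_EFinP; apply: measurable_funM => //.
    exact: measurable_funS (measurable_powR _).
  move=> x; rewrite /= in_itv/= andbT => x1.
  have x0 : 0 < x by exact: lt_le_trans x1.
  rewrite -EFinM lee_fin /f.
  rewrite ler_pdivrMr//.
  have -> : x `^ (- (a - 1)) = x / x `^ a.
    by rewrite opprB powRD ?(gt_eqF x0) ?implybT// powRr1 ?ltW// powRN.
  have xa : 0 < x `^ a by exact: powR_gt0.
  rewrite mulrDr mulr1 ler_wpDl//; first by rewrite !mulr_ge0 ?invr_ge0// ltW.
  by rewrite le_eqVlt; apply/orP; left; apply/eqP; field; rewrite !gt_eqF.
rewrite ge0_integralZl//; last 3 first.
- apply/measurable_EFinP; exact: measurable_funS (measurable_powR _).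
- by move=> x _; rewrite lee_fin powR_ge0.
- by rewrite lee_fin ltW.
rewrite lte_mul_pinfty ?lee_fin ?(ltW beta0)//; apply: integral_powR_lty.
by rewrite ltrBrDr.
Qed.

Lemma H1_ge0 : 0 <= H1 beta a.
Proof.
apply: Rintegral_ge0 => x; rewrite /= in_itv/= andbT => x1.
by apply: f_ge0; exact: le_trans x1.
Qed.

(* With c = beta^(1/alpha), the integrand of H1 is at least c / 4 on [c/2, c]. *)
Lemma H1_ge : 2 <= beta `^ a^-1 -> (beta `^ a^-1) ^+ 2 / 8 <= H1 beta a.
Proof.
set c := beta `^ a^-1 => c2.
have ca : c `^ a = beta by rewrite /c -powRrM mulVf ?powRr1 ?ltW// gt_eqF.
rewrite -lee_fin /H1 /Rintegral fineK ?H1_integral_fin_num//.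
have cc : c / 2 < c by lra.
have -> : ((c ^+ 2 / 8)%:E = \int[lebesgue_measure]_(x in `[(c / 2)%R, c]) (cst (c / 4)%:E x))%E.
  rewrite integral_cst//= lebesgue_measure_itv/= lte_fin cc -EFinD -EFinM; congr EFin.
  by field.
apply: (@le_trans _ _ (\int[lebesgue_measure]_(x in `[(c / 2)%R, c]) (f x)%:E))%E.
  apply: ge0_le_integral => //=.
  - by move=> x _; rewrite lee_fin; lra.
  - by apply/measurable_EFinP; exact: mf.
  move=> x; rewrite in_itv/= => /andP[cx xc]; rewrite lee_fin /f ler_pdivlMr//.
  (* For [x <= c] one has [x^a <= c^a = beta], so the denominator is at most 2, while the numerator
     is at least [c / 2]. *)
  have : beta^-1 * x `^ a <= 1.
    rewrite mulrC ler_pdivrMr// mul1r -ca.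
    by apply: (ge0_ler_powR (ltW a0)) => //; rewrite nnegrE; lra.
  have := den_gt0 x; nra.
(* Since [c >= 2], the interval [[c/2, c]] lies in the domain of [H1]. *)
apply: ge0_subset_integral => //=.
- by apply/measurable_EFinP; exact: mf.
- move=> x; rewrite in_itv/= andbT lee_fin => x1; apply: f_ge0; exact: le_trans x1.
- by move=> x; rewrite /= !in_itv/= andbT => /andP[cx _]; lra.
Qed.

End H1bounds.

(** * Existence of maximizers, and the minorant on the interval starting at 0 *)

Lemma lipschitz_argmax (R : realType) (f : R -> R) (a b k : R) : a <= b ->
  (forall x y, a <= x -> x <= y -> y <= b -> `|f y - f x| <= k * (y - x)) ->
  argmax f `[a, b] !=set0.
Proof.
move=> ab fk; have [|c cab cmax] := @EVT_max _ f a b ab; last first.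
  by exists c; split => // y; exact: cmax.
have fk' x y : a <= x <= b -> a <= y <= b -> `|f x - f y| <= k * `|x - y|.
  move=> /andP[ax xb] /andP[ay yb]; have [xy|yx] := leP x y.
    by rewrite distrC [X in _ * X]distrC (ger0_norm (_ : 0 <= y - x)) ?subr_ge0 ?fk.
  by rewrite (ger0_norm (_ : 0 <= x - y)) ?subr_ge0 ?fk// ltW.
apply/subspace_continuousP => x; rewrite /= in_itv/= => xab.
(* [k] carries no sign condition, so [|k| + 1] serves as a positive Lipschitz constant. *)
have K0 : 0 < `|k| + 1 by rewrite ltr_pwDr.
apply/cvgrPdist_lt => e e0; near=> y.
have yab : a <= y <= b.
  by have : `[a, b]%classic y by [near: y; exact: withinT]; rewrite /= in_itv.
apply: (le_lt_trans (fk' _ _ xab yab)).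
have xy : `|x - y| < e / (`|k| + 1).
  near: y; apply: cvg_within.
  by apply: (@cvgr_dist_lt _ _ _ (nbhs x) _ id x); [exact: cvg_id|exact: divr_gt0].
apply: (@le_lt_trans _ _ ((`|k| + 1) * `|x - y|)).
  rewrite ler_wpM2r//; apply: le_trans (ler_norm k) _; lra.
by rewrite mulrC -ltr_pdivlMr.
Unshelve. all: end_near.
Qed.

(** With [A = C = 0] the variable cancels and the minorant is affine of slope [(E - D F) / F], also
    at 0 because of the division convention. A nonzero slope puts the maximizer at an end point. *)
Lemma lfrac0_argmax (R : realType) (D E F b t : R) :
  0 < F -> 0 <= b -> b <= 1 -> D * F != E ->
  argmax (lfrac 0 0 D E F) `[0, b] t ->
  t = clamp 0 b (lfrac_peak 0 0 D E F).
Proof.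
move=> F0 b0 b1 DFE [/=]; rewrite in_itv/= => /andP[t0 tb] tmax.
have lin x : lfrac 0 0 D E F x = D + x / F * (E - D * F).
  rewrite /lfrac; have [->|x0] := eqVneq x 0; first by rewrite !mul0r subr0 mul1r addr0 add0r.
  by field; rewrite x0 lt0r_neq0.
rewrite /lfrac_peak; case: (leP (D * F) E) => [DleE|EltD].
  have -> : clamp 0 b 1 = b by rewrite /clamp (max_idPl _) ?ler01// (min_idPr _).
  apply/eqP; rewrite eq_le tb/=.
  have := tmax b; rewrite /= in_itv/= b0 lexx => /(_ isT).
  rewrite !lin lerD2l ler_pM2r ?ler_pM2r ?invr_gt0//.
  by rewrite subr_gt0 lt_neqAle DFE.
rewrite !mul0r sqrtr0 subr0.
have -> : clamp 0 b 0 = 0 by rewrite /clamp maxxx (min_idPl _).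
apply/eqP; rewrite eq_le t0 andbT.
have := tmax 0; rewrite /= in_itv/= b0 lexx => /(_ isT).
by rewrite !lin lerD2l ler_nM2r ?subr_lt0// ler_pM2r ?invr_gt0.
Qed.

Lemma lfrac0_cst (R : realType) (D E F x : R) : 0 < F -> D * F = E ->
  lfrac 0 0 D E F x = D.
Proof.
move=> F0 <-; rewrite /lfrac; have [->|x0] := eqVneq x 0.
  by rewrite !mul0r subr0 mul1r add0r.
by field; rewrite x0 lt0r_neq0.
Qed.

(** * The rate density *)

Section RateDensity.
Context {R : realType} (N : network R).
Context (hM : (0 < M N)%N) (hB : 0 < B N)
  (hlambdaD : forall i : nat, (1 <= i <= M N)%N -> 0 < lambdaD N i)
  (hbD : forall i : nat, (1 <= i <= M N)%N -> 0 < bD N i)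
  (hlambdaU : 0 < lambdaU N) (hbC : 0 < bC N) (hlambdaB : 0 < lambdaB N)
  (hdelta : 0 < delta N) (halpha : 2 < alpha N)
  (hsorted : forall i : nat, (i < M N)%N -> bt N i <= bt N i.+1).

Let alpha0 : 0 < alpha N. Proof. by apply: lt_trans halpha; lra. Qed.
Let g0 : 0 < 2 / alpha N. Proof. by rewrite divr_gt0. Qed.
Let g1 : 2 / alpha N <= 1. Proof. by rewrite ler_pdivrMr// mul1r ltW. Qed.

Lemma interf_gt0 : 0 < interf N.
Proof.
have p0 := pi_gt0 R.
rewrite /interf mulr_gt0//; first by rewrite mulr_gt0// exprn_gt0.
rewrite divr_gt0//; first by rewrite divr_gt0// mulr_gt0// exprn_gt0.
(* [alpha > 2] puts [2 pi / alpha] strictly between 0 and [pi]. *)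
apply: sin_gt0_pi; rewrite divr_gt0 ?mulr_gt0//=.
by rewrite ltr_pdivrMr// mulrC ltr_pM2l.
Qed.

Lemma log2_gt0 (b : R) : 0 < b -> 0 < log2 (1 + b).
Proof. by move=> b0; rewrite divr_gt0// ln_gt0//; lra. Qed.

Lemma log2_1D_le (b : R) : 0 < b ->
  log2 (1 + b) <= 2 / (2 / alpha N) / ln 2 * (1 + b `^ (2 / alpha N)).
Proof.
move=> b0; rewrite /log2 ler_pdivrMr ?ln_gt0//; last by lra.
rewrite mulrAC divfK; last by rewrite gt_eqF// ln_gt0//; lra.
by apply: ln1D_le_powR => //; exact: ltW.
Qed.

(** The density of interfering D2D links, that is [s / theta] for positive [theta]; it is the
    argument [w] of [spectral]. *)
Definition active (theta : R) : R :=
  \sum_(1 <= i < (M N).+1) pf_opt N theta i * lambdaD N i.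

Definition spectral (w b : R) : R :=
  log2 (1 + b) / (1 + interf N * b `^ (2 / alpha N) * w).

Definition max_spectral (w : R) : R := sup [set spectral w b | b in thresholds].

Definition cellular (b : R) : R := log2 (1 + b) * PC N b.

(** What is left of [lambdaU * bC * pa] per unit of [1 - theta]. *)
Definition cellular_scale : R := 7 * B N * lambdaB N / 9.

Lemma cellular_scale_gt0 : 0 < cellular_scale.
Proof. by rewrite divr_gt0// !mulr_gt0. Qed.

Lemma thresholds_neq0 : @thresholds R !=set0.
Proof. by exists 1; rewrite /thresholds/=. Qed.

Lemma bt_gt0 i : (1 <= i <= M N)%N -> 0 < bt N i.
Proof. by case: i => // i /hbD bi; rewrite /bt divr_gt0. Qed.

(** * Monotonicity of the interference density in the partition *)

Lemma pf_optM (theta : R) i : 0 <= theta -> (1 <= i <= M N)%N ->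
  pf_opt N theta i * theta = Num.min theta (bt N i).
Proof.
(* At [theta = 0] the conventional value 1 of [pf_opt] is multiplied by 0. *)
move=> t0 /bt_gt0 bi; rewrite /pf_opt; case: eqVneq => [->|tn0].
  by rewrite mulr0 (min_idPl _)// ltW.
have tp : 0 < theta by rewrite lt_def tn0.
by rewrite minr_pMl// mul1r divfK.
Qed.

Lemma pf_opt_gt0 (theta : R) i : 0 <= theta -> (1 <= i <= M N)%N -> 0 < pf_opt N theta i.
Proof.
move=> t0 /bt_gt0 bi; rewrite /pf_opt; case: eqVneq => // tn0.
by rewrite lt_min ltr01 divr_gt0// lt_def tn0.
Qed.

Lemma pf_opt_anti (theta1 theta2 : R) i : 0 <= theta1 -> theta1 <= theta2 ->
  (1 <= i <= M N)%N -> pf_opt N theta2 i <= pf_opt N theta1 i.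
Proof.
move=> t0 t12 /bt_gt0 bi; rewrite /pf_opt; case: (eqVneq theta1 0) => [_|tn1].
  by case: eqP => // _; rewrite ge_min lexx.
have t1 : 0 < theta1 by rewrite lt_def tn1.
have t2 : 0 < theta2 by exact: lt_le_trans t12.
rewrite gt_eqF// le_min ge_min lexx/= ge_min; apply/orP; right.
by rewrite ler_pM2l// lef_pV2.
Qed.

Lemma active_gt0 (theta : R) : 0 <= theta -> 0 < active theta.
Proof.
move=> t0; rewrite /active big_ltn//.
rewrite ltr_pwDl//; first by rewrite mulr_gt0 ?pf_opt_gt0 ?hlambdaD.
rewrite big_nat; apply: sumr_ge0 => i /andP[i1 i2].
have iM : (1 <= i <= M N)%N by rewrite ltnW.
by rewrite mulr_ge0 ?ltW ?pf_opt_gt0 ?hlambdaD.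
Qed.

Lemma active_anti (theta1 theta2 : R) : 0 <= theta1 -> theta1 <= theta2 ->
  active theta2 <= active theta1.
Proof.
move=> t0 t12; rewrite /active !big_nat; apply: ler_sum => i iM.
by rewrite ler_wpM2r ?pf_opt_anti// ltW// hlambdaD.
Qed.

Lemma active_scaled (theta : R) : 0 <= theta ->
  theta * active theta = \sum_(1 <= i < (M N).+1) lambdaD N i * Num.min theta (bt N i).
Proof.
move=> t0; rewrite /active mulr_sumr !big_nat; apply: eq_bigr => i iM.
by rewrite -pf_optM// mulrCA mulrA mulrC.
Qed.

Lemma active_scaled_mono (theta1 theta2 : R) : 0 <= theta1 -> theta1 <= theta2 ->
  theta1 * active theta1 <= theta2 * active theta2.
Proof.
move=> t0 t12; rewrite !active_scaled//; last exact: le_trans t12.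
rewrite !big_nat; apply: ler_sum => i iM; rewrite ler_wpM2l//; first by rewrite ltW ?hlambdaD.
by rewrite le_min !ge_min t12 lexx orbT.
Qed.

(** The two minima merge into [B * min(theta, bt j)], so the threshold enters the rates of all types
    through the same factor. *)
Lemma RD_atE (theta : R) j (b : R) : 0 <= theta -> (1 <= j <= M N)%N ->
  RD_at N theta j b = B N * Num.min theta (bt N j) * spectral (active theta) b.
Proof.
move=> t0 jM; rewrite /RD_at pf_optM// /spectral /PD /active mulrA.
congr (_ * _ * _).
  rewrite (mulrC _ (B N)).
  have -> : bD N j = B N * bt N j by case: j jM => // j _; rewrite /bt mulrC divfK// gt_eqF.
  by rewrite (min_idPl _)// ler_pM2l// ge_min lexx orbT.
rewrite div1r; congr (_ + _ * _)^-1.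
by apply: eq_bigr => i _; rewrite /pt_opt mul1r.
Qed.

(** * Suprema over the thresholds *)

Lemma interfM_ge0 (b : R) : 0 <= interf N * b `^ (2 / alpha N).
Proof. by apply: mulr_ge0; [exact: ltW interf_gt0|exact: powR_ge0]. Qed.

Lemma spectral_den_gt0 (w b : R) : 0 <= w -> 0 < 1 + interf N * b `^ (2 / alpha N) * w.
Proof.
by move=> w0; rewrite ltr_pwDl//; apply: mulr_ge0 => //; exact: interfM_ge0.
Qed.

Lemma spectral_gt0 (w b : R) : 0 <= w -> 0 < b -> 0 < spectral w b.
Proof. by move=> w0 b0; rewrite divr_gt0 ?log2_gt0 ?spectral_den_gt0. Qed.

Lemma has_ubound_spectral (w : R) : 0 < w -> has_ubound [set spectral w b | b in thresholds].
Proof.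
(* The denominator of [spectral] is at least [m (1 + b^(2 / alpha))], matching the growth bound on
   the numerator. *)
move=> w0; set m := Num.min 1 (interf N * w).
have m0 : 0 < m by rewrite lt_min ltr01 mulr_gt0// interf_gt0.
exists (2 / (2 / alpha N) / ln 2 / m) => _ [b b0 <-].
rewrite /spectral ler_pdivrMr ?spectral_den_gt0 ?(ltW w0)//.
apply: (le_trans (log2_1D_le b0)); set c := _ / ln 2.
have c0 : 0 <= c by rewrite divr_ge0 ?divr_ge0 ?ln_ge0 ?(ltW alpha0)//; lra.
rewrite -(mulrA c) ler_wpM2l// [leRHS]mulrC ler_pdivlMr// mulrDl mul1r lerD//.
  by rewrite ge_min lexx.
by rewrite mulrAC [leRHS]mulrC ler_wpM2l ?powR_ge0// ge_min lexx orbT.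
Qed.

Lemma spectral_le_max (w b : R) : 0 < w -> 0 < b -> spectral w b <= max_spectral w.
Proof. by move=> w0 b0; apply: ub_le_sup; [exact: has_ubound_spectral|exists b]. Qed.

Lemma max_spectral_ge0 (w : R) : 0 < w -> 0 <= max_spectral w.
Proof.
move=> w0; apply: le_trans (spectral_le_max w0 ltr01).
by rewrite ltW ?spectral_gt0 ?ltW.
Qed.

Lemma max_spectral_anti (w1 w2 : R) : 0 < w1 -> w1 <= w2 -> max_spectral w2 <= max_spectral w1.
Proof.
move=> w0 w12; have w20 : 0 < w2 by exact: lt_le_trans w12.
apply: ge_sup; first by have [b b0] := thresholds_neq0; exists (spectral w2 b), b.
move=> _ [b b0 <-]; apply: le_trans (spectral_le_max w0 b0).
rewrite ler_pM2l ?log2_gt0// lef_pV2 ?posrE ?spectral_den_gt0 ?(ltW w0) ?(ltW w20)//.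
by rewrite lerD2l ler_wpM2l// interfM_ge0.
Qed.

(** For each threshold, [w * spectral w b] is [log2 (1 + b)] over [1 / w + k] with [k >= 0], hence
    nondecreasing in [w]. *)
Lemma max_spectralM_mono (w1 w2 : R) : 0 < w1 -> w1 <= w2 ->
  w1 * max_spectral w1 <= w2 * max_spectral w2.
Proof.
move=> w0 w12; have w20 : 0 < w2 by exact: lt_le_trans w12.
rewrite mulrC -ler_pdivlMr//.
apply: ge_sup; first by have [b b0] := thresholds_neq0; exists (spectral w1 b), b.
move=> _ [b b0 <-]; rewrite ler_pdivlMr//.
apply: (@le_trans _ _ (w2 * spectral w2 b)); last by rewrite ler_pM2l// spectral_le_max.
have := spectral_den_gt0 b (ltW w0); have := spectral_den_gt0 b (ltW w20).
rewrite /spectral; set k := interf N * _; have k0 : 0 <= k by exact: interfM_ge0.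
move=> d2 d1; rewrite [leLHS]mulrC [leLHS]mulrCA [leRHS]mulrCA ler_pM2l ?log2_gt0//.
by rewrite ler_pdivrMr// mulrAC ler_pdivlMr// !mulrDr !mulr1 lerD// mulrCA [leRHS]mulrCA (mulrC w1).
Qed.

Lemma RDE (theta : R) j : 0 <= theta -> (1 <= j <= M N)%N ->
  RD N theta j = B N * Num.min theta (bt N j) * max_spectral (active theta).
Proof.
move=> t0 jM; rewrite -sup_imageZ; last 3 first.
- by rewrite mulr_ge0 ?(ltW hB)// le_min t0 ltW ?bt_gt0.
- exact: thresholds_neq0.
- exact/has_ubound_spectral/active_gt0.
by congr sup; apply: eq_imagel => b _; rewrite RD_atE.
Qed.

Lemma PC_den_ge (b : R) : 0 < b -> (1 + b `^ (2 / alpha N)) / 8 <= 2 * H1 b (alpha N) + 1.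
Proof.
move=> b0; have H0 := H1_ge0 (alpha N) b0.
have -> : b `^ (2 / alpha N) = (b `^ (alpha N)^-1) ^+ 2.
  by rewrite mulrC powRrM powR_mulrn ?powR_ge0.
have := @H1_ge _ _ _ b0 halpha; have := powR_ge0 b (alpha N)^-1.
move: (_ `^ _) (H1 _ _) H0 => c h h0 c0.
(* For [c >= 2] this is [H1_ge]; for [c < 2] the left side is below [5/8], while the right side is
   at least 1. *)
by have [c2 /(_ isT)|c2 _] := leP 2 c; nra.
Qed.

Lemma has_ubound_cellular : has_ubound [set cellular b | b in thresholds].
Proof.
set c := 2 / (2 / alpha N) / ln 2.
exists (8 * c) => _ [b b0 <-].
have p0 : 0 < 1 + b `^ (2 / alpha N) by rewrite ltr_pwDl ?powR_ge0.
have H := PC_den_ge b0.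
have d0 : 0 < 2 * H1 b (alpha N) + 1 by apply: lt_le_trans H; rewrite divr_gt0.
rewrite /cellular /PC div1r ler_pdivrMr//; apply: (le_trans (log2_1D_le b0)).
have c0 : 0 <= c by rewrite divr_ge0 ?divr_ge0 ?ln_ge0 ?(ltW alpha0)//; lra.
rewrite -/c (mulrC 8) -(mulrA c) ler_wpM2l//; lra.
Qed.

Definition max_cellular : R := sup [set cellular b | b in thresholds].

Lemma cellular_le_max (b : R) : 0 < b -> cellular b <= max_cellular.
Proof. by move=> b0; apply: ub_le_sup; [exact: has_ubound_cellular|exists b]. Qed.

Lemma RC_atE (theta b : R) :
  lambdaU N * RC_at N theta b = (1 - theta) * cellular_scale * cellular b.
Proof.
rewrite /RC_at /pa /cellular /cellular_scale; set l := log2 _; set p := PC N b.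
by field; rewrite !gt_eqF.
Qed.

Lemma RCE (theta : R) : theta <= 1 ->
  lambdaU N * RC N theta = (1 - theta) * cellular_scale * max_cellular.
Proof.
move=> t1; rewrite -[RHS]sup_imageZ; last 3 first.
- by rewrite mulr_ge0 ?subr_ge0// ltW// cellular_scale_gt0.
- exact: thresholds_neq0.
- exact: has_ubound_cellular.
rewrite -[LHS]sup_imageZ ?(ltW hlambdaU)//; last 2 first.
- exact: thresholds_neq0.
- have [m ubm] := has_ubound_cellular.
  exists ((lambdaU N)^-1 * ((1 - theta) * cellular_scale * m)) => _ [b b0 <-].
  rewrite -(ler_pM2l hlambdaU) RC_atE mulVKf ?gt_eqF//.
  rewrite ler_wpM2l//; last by apply: ubm; exists b.
  by rewrite mulr_ge0 ?subr_ge0// ltW// cellular_scale_gt0.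
by congr sup; apply: eq_imagel => b _; rewrite RC_atE.
Qed.

(** * Closed form of the rate density, its Lipschitz bound and its maximizer *)

Lemma rate_densityE (theta : R) : 0 <= theta <= 1 ->
  rate_density N theta =
  B N * (theta * active theta) * max_spectral (active theta)
  + (1 - theta) * cellular_scale * max_cellular.
Proof.
move=> /andP[t0 t1]; rewrite /rate_density RCE//; congr (_ + _).
rewrite active_scaled// mulr_sumr mulr_suml !big_nat; apply: eq_bigr => j jM.
by rewrite RDE// !mulrA (mulrC (lambdaD N j)).
Qed.

Lemma rate_density_lipschitz (x y : R) : 0 <= x -> x <= y -> y <= 1 ->
  `|rate_density N y - rate_density N x| <=
  (B N * (active 0 * max_spectral (active 0)) + `|cellular_scale * max_cellular|) * (y - x).
Proof.
move=> x0 xy y1; have y0 := le_trans x0 xy; have x1 := le_trans xy y1.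
have ax := active_gt0 x0; have ay := active_gt0 y0.
have ayx := active_anti x0 xy; have ax0 := active_anti (lexx 0) x0.
rewrite !rate_densityE ?x0 ?y0//; set T := fun t => t * active t * max_spectral (active t).
have -> : B N * (y * active y) * max_spectral (active y)
    + (1 - y) * cellular_scale * max_cellular
    - (B N * (x * active x) * max_spectral (active x)
       + (1 - x) * cellular_scale * max_cellular)
    = B N * (T y - T x) - cellular_scale * max_cellular * (y - x) by rewrite /T; ring.
(* Both [t * active t] and [max_spectral (active t)] are nonnegative and nondecreasing in [t]. *)
have T1 : 0 <= T y - T x.
  rewrite subr_ge0; apply: ler_pM; rewrite ?max_spectral_ge0//.
  - by rewrite mulr_ge0// ltW.
  - exact: active_scaled_mono.
  - exact: max_spectral_anti.
(* Grouped the other way, [T t] is [t] times a factor that is nonincreasing in [t] and bounded by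
   its value at 0. *)
have T2 : T y - T x <= active 0 * max_spectral (active 0) * (y - x).
  have V1 := max_spectralM_mono ay ayx; have V2 := max_spectralM_mono ax ax0.
  rewrite /T -(mulrA y) -(mulrA x).
  move: (active y * max_spectral _) (active x * max_spectral _) (active 0 * max_spectral _)
    V1 V2 => u v w uv vw.
  have := ler_wpM2l y0 uv; have : 0 <= (y - x) * (w - v) by rewrite mulr_ge0 ?subr_ge0.
  lra.
apply: (le_trans (ler_normB _ _)).
rewrite mulrDl lerD//; last first.
  by rewrite normrM (ger0_norm (_ : 0 <= y - x)) // subr_ge0.
by rewrite ger0_norm ?mulr_ge0 ?(ltW hB)// -mulrA ler_pM2l.
Qed.

Lemma rate_density_argmax : argmax (rate_density N) `[0, 1] !=set0.
Proof.
by apply: lipschitz_argmax rate_density_lipschitz; exact: ler01.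
Qed.

(** * Intervals between consecutive normalized demands *)

Lemma bt_mono i j : (i <= j)%N -> (j <= M N)%N -> bt N i <= bt N j.
Proof.
elim: j => [|j IHj]; first by rewrite leqn0 => /eqP ->.
rewrite leq_eqVlt => /orP[/eqP ->//|]; rewrite ltnS => ij jM.
exact: le_trans (IHj ij (ltnW jM)) (hsorted jM).
Qed.

Lemma leq_LP i : (i <= L N)%N = (i <= M N)%N && (bt N i < 1).
Proof.
apply/idP/andP => [iL|[iM bi]].
  (* Index 0 satisfies [bt N 0 = 0 < 1], so the maximum defining [L] is attained. *)
  have [k bk Lk] : {k : 'I_(M N).+1 | bt N k < 1 & L N = k}.
    by apply: eq_bigmax_cond; apply/card_gt0P; exists ord0; exact: ltr01.
  have ik : (i <= k)%N by rewrite -Lk.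
  have kM : (k <= M N)%N by rewrite -ltnS.
  by split; [exact: leq_trans kM|apply: le_lt_trans bk; exact: bt_mono].
exact: (@leq_bigmax_cond _ (fun k : 'I_(M N).+1 => bt N k < 1) val (Ordinal (_ : i < (M N).+1)%N)).
Qed.

Lemma right_end_le1 i : right_end N i <= 1.
Proof. by rewrite /right_end; case: ifP => // _; rewrite ge_min lexx. Qed.

Lemma bt_le_right_end i : (i <= L N)%N -> bt N i <= right_end N i.
Proof.
rewrite leq_LP => /andP[iM bi]; rewrite /right_end; case: ifP => [iM'|_]; last exact: ltW.
by rewrite le_min (ltW bi) hsorted.
Qed.

Lemma bt_ge0 i : (i <= M N)%N -> 0 <= bt N i.
Proof. by case: i => // i iM; rewrite ltW// bt_gt0. Qed.

Lemma candidates_sub (betaD betaC : R) : candidates N betaD betaC `<=` `[0, 1].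
Proof.
move=> _ [i /= iL <-]; rewrite in_itv/=.
have /andP[lo hi] := clamp_bounds (bt' N betaD betaC i) (bt_le_right_end iL).
have iM : (i <= M N)%N by move: iL; rewrite leq_LP => /andP[].
by rewrite (le_trans (bt_ge0 iM) lo) (le_trans hi (right_end_le1 i)).
Qed.

Lemma exists_bt_interval (t : R) : 0 <= t <= 1 ->
  exists2 i : nat, (i <= L N)%N & bt N i <= t <= right_end N i.
Proof.
move=> /andP[t0 t1].
have [tn0|t0'] := leP t 0.
  exists 0%N => //; have -> : t = 0 by apply/eqP; rewrite eq_le tn0.
  rewrite lexx/= -[0]/(bt N 0); exact: bt_le_right_end.
(* The largest [i] with [bt N i < t] is chosen; [t = 0] is treated apart, as no index satisfies this
   strict inequality there. *)
pose P i := (i <= M N)%N && (bt N i < t).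
have exP : exists i, P i by exists 0%N; rewrite /P/= t0'.
have ubP i : P i -> (i <= M N)%N by case/andP.
case: (ex_maxnP exP ubP) => i /andP[iM bi] imax.
exists i; first by rewrite leq_LP iM (lt_le_trans bi t1).
rewrite (ltW bi)/= /right_end; case: ifP => // iM'; rewrite le_min t1/=.
by rewrite leNgt; apply/negP => bi'; have := imax i.+1; rewrite /P iM' bi' ltnn => /(_ isT).
Qed.

(** On this interval [min(theta, bt j)] is [bt j] for [j <= i] and [theta] for [j > i]. *)
Lemma active_scaled_on_interval (theta : R) i : (i <= M N)%N -> 0 <= theta ->
  bt N i <= theta <= right_end N i ->
  theta * active theta = \sum_(1 <= j < i.+1) lambdaD N j * bt N j
    + theta * \sum_(i.+1 <= j < (M N).+1) lambdaD N j.
Proof.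
move=> iM t0 /andP[bi ti]; rewrite active_scaled// (@big_cat_nat _ _ _ i.+1)//=.
congr (_ + _).
  rewrite !big_nat; apply: eq_bigr => j /andP[_ ji].
  by rewrite (min_idPr _)//; apply: le_trans bi; apply: bt_mono.
rewrite mulr_sumr !big_nat; apply: eq_bigr => j /andP[ij jM].
rewrite mulrC (min_idPl _)//; apply: (le_trans ti).
rewrite /right_end (leq_trans ij jM) ge_min; apply/orP; right.
exact: bt_mono.
Qed.

Lemma lfrac_on_interval (betaD D theta : R) i : (i <= M N)%N -> 0 <= theta ->
  bt N i <= theta <= right_end N i ->
  lfrac (coeff_A N betaD i) (coeff_C N betaD i) D
    (coeff_E N betaD i) (coeff_F N betaD i) theta
  = B N * (theta * active theta) * spectral (active theta) betaD + (1 - theta) * D.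
Proof.
move=> iM t0 ti; rewrite /lfrac; congr (_ + _).
have [->|tn0] := eqVneq theta 0; first by rewrite !mul0r mulr0 mul0r.
have s_eq := active_scaled_on_interval iM t0 ti.
(* Multiplying the denominator of [spectral] by [theta] turns it into [C + F theta]. *)
have d0 : 0 < theta * (1 + interf N * betaD `^ (2 / alpha N) * active theta).
  by rewrite mulr_gt0 ?spectral_den_gt0 ?(ltW (active_gt0 _))// lt_def tn0.
rewrite /coeff_A /coeff_C /coeff_E /coeff_F /spectral (addrC betaD).
move: (interf N * _) d0 => k d0; set a := \sum_(1 <= j < i.+1) _ in s_eq *.
set e := \sum_(i.+1 <= j < _) _ in s_eq *.
have -> : k * a + (k * e + 1) * theta = theta * (1 + k * active theta).
  by rewrite mulrDr mulr1 mulrCA s_eq; ring.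
have -> : B N * log2 (1 + betaD) * a + B N * log2 (1 + betaD) * e * theta
    = B N * log2 (1 + betaD) * (theta * active theta) by rewrite s_eq; ring.
have dn : 1 + k * active theta != 0 by move: d0; apply: contraTneq => ->; rewrite mulr0 ltxx.
by field; rewrite tn0 dn.
Qed.

(** * Signs of the coefficients *)

Lemma lambda_sum_ge0 (c : nat -> R) i j : (i <= M N)%N ->
  (forall k, (1 <= k <= M N)%N -> 0 <= c k) ->
  0 <= \sum_(j.+1 <= k < i.+1) lambdaD N k * c k.
Proof.
move=> iM c0; rewrite big_nat; apply: sumr_ge0 => k /andP[jk ki].
have kM : (1 <= k <= M N)%N by rewrite (leq_trans _ jk)// (leq_trans _ iM).
by rewrite mulr_ge0 ?c0// ltW ?hlambdaD.
Qed.

Lemma coeff_F_gt0 (betaD : R) i : 0 < coeff_F N betaD i.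
Proof.
rewrite ltr_pwDr// mulr_ge0 ?interfM_ge0//.
under eq_bigr do rewrite -[lambdaD N _]mulr1.
exact: (@lambda_sum_ge0 (fun=> 1)).
Qed.

Lemma lambda_bt_sum_gt0 i : (0 < i <= M N)%N ->
  0 < \sum_(1 <= j < i.+1) lambdaD N j * bt N j.
Proof.
case: i => // i iM; rewrite big_nat_recr// ltr_wpDl//.
  by apply: lambda_sum_ge0 => [|k kM]; [exact: ltnW|rewrite ltW ?bt_gt0].
by rewrite mulr_gt0 ?hlambdaD ?bt_gt0.
Qed.

Lemma coeff_C_gt0 (betaD : R) i : 0 < betaD -> (0 < i <= M N)%N -> 0 < coeff_C N betaD i.
Proof.
by move=> b0 iM; rewrite /coeff_C pmulr_rgt0 ?lambda_bt_sum_gt0// pmulr_rgt0 ?powR_gt0// interf_gt0.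
Qed.

(** The products of the two sums cancel and [A F - E C] reduces to [A]. *)
Lemma coeff_AF_EC_gt0 (betaD : R) i : 0 < betaD -> (0 < i <= M N)%N ->
  0 < coeff_A N betaD i * coeff_F N betaD i - coeff_E N betaD i * coeff_C N betaD i.
Proof.
move=> b0 iM; have s0 := lambda_bt_sum_gt0 iM.
rewrite [ltRHS](_ : _ = B N * log2 (1 + betaD) * \sum_(1 <= j < i.+1) lambdaD N j * bt N j).
  by rewrite mulr_gt0// mulr_gt0// log2_gt0.
by rewrite /coeff_A /coeff_C /coeff_E /coeff_F (addrC 1 betaD); ring.
Qed.

(** * Comparison of the minorant with the rate density *)

Lemma coeff_DE (betaC : R) : coeff_D N betaC = cellular_scale * cellular betaC.
Proof. by rewrite /coeff_D /cellular /PC div1r addrC. Qed.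

Lemma lfrac_le_rate (betaD betaC theta : R) i : (i <= L N)%N -> 0 < betaD -> 0 < betaC ->
  bt N i <= theta <= right_end N i ->
  lfrac (coeff_A N betaD i) (coeff_C N betaD i) (coeff_D N betaC)
    (coeff_E N betaD i) (coeff_F N betaD i) theta <= rate_density N theta.
Proof.
rewrite leq_LP => /andP[iM _] bD0 bC0 ti; have /andP[bi tr] := ti.
have t0 := le_trans (bt_ge0 iM) bi; have t1 := le_trans tr (right_end_le1 i).
have a0 := active_gt0 t0.
rewrite lfrac_on_interval// rate_densityE ?t0// lerD//.
  rewrite ler_wpM2l ?spectral_le_max//.
  by apply: mulr_ge0; [exact: ltW|apply: mulr_ge0; [|exact: ltW]].
rewrite coeff_DE mulrA ler_wpM2l ?cellular_le_max// mulr_ge0 ?subr_ge0//.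
exact: ltW cellular_scale_gt0.
Qed.

Lemma lfrac_eq_rate (betaD betaC theta : R) i : (i <= L N)%N ->
  (forall j : nat, (1 <= j <= M N)%N -> argmax (RD_at N theta j) thresholds betaD) ->
  argmax (RC_at N theta) thresholds betaC ->
  bt N i <= theta <= right_end N i ->
  lfrac (coeff_A N betaD i) (coeff_C N betaD i) (coeff_D N betaC)
    (coeff_E N betaD i) (coeff_F N betaD i) theta = rate_density N theta.
Proof.
rewrite leq_LP => /andP[iM _] hDs hC ti; have /andP[bi tr] := ti.
have t0 := le_trans (bt_ge0 iM) bi; have t1 := le_trans tr (right_end_le1 i).
rewrite lfrac_on_interval// rate_densityE ?t0//; congr (_ + _).
  (* At [theta = 0] every threshold maximizes the vanishing D2D rates, but the D2D term is then 0 on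
     both sides. The case [theta = 1] of the cellular term is alike. *)
  have [->|tn0] := eqVneq theta 0; first by rewrite !mul0r mulr0 !mul0r.
  congr (_ * _); apply/esym; apply: sup_argmax.
  (* Type 1 represents all types, whose rates are positive multiples of the same [spectral]. *)
  have [bD0 hDmax] := hDs 1%N hM.
  split=> // y y0; have := hDmax y y0; rewrite !RD_atE//.
  by rewrite ler_pM2l// mulr_gt0// lt_min lt_def tn0 t0 bt_gt0.
have [->|tn1] := eqVneq theta 1; first by rewrite subrr !mul0r.
rewrite coeff_DE mulrA; congr (_ * _); apply/esym; apply: sup_argmax.
have [bC0 hCmax] := hC; split=> // y y0; have := hCmax y y0.
rewrite -(ler_pM2l hlambdaU) !RC_atE ler_pM2l// mulr_gt0 ?cellular_scale_gt0//.
by rewrite subr_gt0 lt_neqAle tn1.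
Qed.

End RateDensity.

(** * Optimal partitions among the clamped stationary points *)

Theorem proposition6 (R : realType) (N : network R)
  (hM : (0 < M N)%N) (hB : 0 < B N)
  (hlambdaD : forall i : nat, (1 <= i <= M N)%N -> 0 < lambdaD N i)
  (hbD : forall i : nat, (1 <= i <= M N)%N -> 0 < bD N i)
  (hlambdaU : 0 < lambdaU N) (hbC : 0 < bC N) (hlambdaB : 0 < lambdaB N)
  (hdelta : 0 < delta N) (halpha : 2 < alpha N)
  (hsorted : forall i : nat, (i < M N)%N -> bt N i <= bt N i.+1)
  (hheavy : forall theta : R, 0 <= theta <= 1 -> heavily_loaded N theta) :
  argmax (rate_density N) `[0, 1] !=set0 /\
  forall thetaopt betaD betaC : R,
    argmax (rate_density N) `[0, 1] thetaopt ->
    (forall j : nat, (1 <= j <= M N)%N ->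
       argmax (RD_at N thetaopt j) thresholds betaD) ->
    argmax (RC_at N thetaopt) thresholds betaC ->
    [/\ candidates N betaD betaC `&` argmax (rate_density N) `[0, 1] !=set0,
        argmax (rate_density N) (candidates N betaD betaC)
          = candidates N betaD betaC `&` argmax (rate_density N) `[0, 1]
      & coeff_E N betaD 0 <> coeff_D N betaC * coeff_F N betaD 0 ->
          candidates N betaD betaC thetaopt].
Proof.
split; first exact: rate_density_argmax.
move=> t betaD betaC topt hDs hC.
have [/= tin tmax] := topt; have [bD0 _] := hDs 1%N hM; have [bC0 _] := hC.
rewrite in_itv/= in tin.
have [i iL ti] := exists_bt_interval hsorted tin.
have iM : (i <= M N)%N by move: iL; rewrite leq_LP// => /andP[].
pose A := coeff_A N betaD i; pose C := coeff_C N betaD i.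
pose D := coeff_D N betaC; pose E := coeff_E N betaD i.
pose F := coeff_F N betaD i; pose f := lfrac A C D E F.
have F0 : 0 < F by exact: coeff_F_gt0.
have f_le x : bt N i <= x <= right_end N i -> f x <= rate_density N x.
  by move=> xi; exact: lfrac_le_rate.
have ft : f t = rate_density N t by exact: lfrac_eq_rate.
have bi0 : 0 <= bt N i by exact: bt_ge0.
have ab : bt N i <= right_end N i by exact: bt_le_right_end.
have r1 := right_end_le1 N i.
(* A minorant touching the rate density at its global maximizer [t] is itself maximal there. *)
have fmax : argmax f `[bt N i, right_end N i] t.
  split; rewrite /= ?in_itv//= => x; rewrite in_itv/= => xi.
  rewrite ft; apply: le_trans (f_le _ xi) _; apply: tmax.
  by case/andP: xi => bx xr; rewrite /= in_itv/= (le_trans bi0)// (le_trans xr).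
set c := clamp (bt N i) (right_end N i) (bt' N betaD betaC i).
have cc : candidates N betaD betaC c by exists i.
have sub : candidates N betaD betaC `<=` `[0, 1] by exact: candidates_sub.
have ci : bt N i <= c <= right_end N i by exact: clamp_bounds.
(* For [i > 0] the coefficients are strictly positive and the clamped peak is the only maximizer;
   for [i = 0] the sums in [A] and [C] are empty and the minorant is affine. *)
have t_or : t = c \/ i = 0%N /\ D * F = E.
  have [i0|i_gt0] := posnP i; last first.
    left; apply: (lfrac_argmax F0) fmax => //.
      by apply: coeff_C_gt0; rewrite // i_gt0.
    by apply: coeff_AF_EC_gt0; rewrite // i_gt0.
  have A0 : A = 0 by rewrite /A i0 /coeff_A big_geq ?mulr0.
  have C0 : C = 0 by rewrite /C i0 /coeff_C big_geq ?mulr0.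
  have [DFE|DFE] := eqVneq (D * F) E; [by right|left].
  rewrite /c /bt' -/A -/C -/D -/E -/F A0 C0.
  have b0 : bt N i = 0 by rewrite i0.
  move: fmax ab; rewrite /f A0 C0 b0 => fmax ab.
  exact: lfrac0_argmax fmax.
have c_opt : argmax (rate_density N) `[0, 1] c.
  case: t_or => [<-//|[i0 DFE]]; split; first exact: sub cc.
  move=> y y01; apply: le_trans (tmax y y01) _.
  (* In the exceptional case the minorant is constant, so the rate at [c] is at least [f c = f t],
     the optimal rate. *)
  apply: le_trans (f_le _ ci); rewrite -ft /f.
  have -> : A = 0 by rewrite /A i0 /coeff_A big_geq ?mulr0.
  have -> : C = 0 by rewrite /C i0 /coeff_C big_geq ?mulr0.
  by rewrite !lfrac0_cst.
split; first by exists c.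
(* Since the candidate [c] is globally optimal, a best candidate reaches the global maximum. *)
- apply/seteqP; split=> x [xc xmax]; split => //; last by move=> y /sub; exact: xmax.2.
  split=> [|y y01]; first exact: sub xc.
  exact: le_trans (c_opt.2 y y01) (xmax c cc).
- by case: t_or => [->//|[i0]]; rewrite /D /E /F i0 => -> [].
Qed.
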